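(* Let $p_1$ and $p_2$ be different prime numbers such that $p_2\mid (p_1-1)$, and let $k$ be a positive integer. Then there exists a simple left brace of order $p_1\cdot p_2^{k(p_1-1)+1}$.
   Context: A left brace is a set $B$ with two binary operations $+$ and $\cdot$ such that $(B,+)$ is an abelian group, $(B,\cdot)$ is a group, and $a\cdot(b+c)+a=a\cdot b+a\cdot c$ for all $a,b,c\in B$. For $b\in B$ put $\lambda_b(x)=b\cdot x-b$. An ideal of $B$ is a normal subgroup $I$ of $(B,\cdot)$ such that $\lambda_b(x)\in I$ for all $b\in B$, $x\in I$. A simple left brace is a non-zero left brace $B$ whose only ideals are $0$ and $B$. The order of a finite left brace is its number of elements. *)

(* Defs.v *)
From HB Require Import structures.
From mathcomp Require Import all_boot all_order all_algebra all_fingroup.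

Set Implicit Arguments.
Unset Strict Implicit.
Unset Printing Implicit Defensive.

Import GRing.Theory.
Local Open Scope ring_scope.

(* A left brace has two group structures on one type: the abelian group
   operation is + of ring_scope, the brace product is * of group_scope.
   Types such as 'Z_n already have + as their group_scope operation, so a brace
   should be built on an alias of such a type.  The name Group is qualified
   because fingroup reuses it for the constructor of {group gT}. *)
HB.mixin Record Zmodule_Group_isLeftBrace B
    of GRing.Zmodule B & monoid.Group B := {
  brace_mulgDr : forall a b c : B,
    (a * (b + c))%g + a = (a * b)%g + (a * c)%g
}.

#[short(type="leftBraceType")]
HB.structure Definition LeftBrace :=
  {B of GRing.Zmodule B & monoid.Group B & Zmodule_Group_isLeftBrace B}.

#[short(type="finLeftBraceType")]
HB.structure Definition FinLeftBrace := {B of LeftBrace B & FinGroup B}.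

Definition brace_lambda (B : leftBraceType) (b x : B) : B := (b * x)%g - b.

(* {group B} and normality refer to the multiplicative group of B. *)
Definition brace_ideal (B : finLeftBraceType) (I : {group B}) : Prop :=
  (I <| [set: B])%g /\ forall b x : B, x \in I -> brace_lambda b x \in I.

Definition simple_left_brace (B : finLeftBraceType) : Prop :=
  (exists x : B, x != 0) /\
  forall I : {group B}, brace_ideal I -> I :=: [set 0] \/ I :=: [set: B].

(* Main.v *)
Require Import Defs.
From HB Require Import structures.
From mathcomp Require Import all_boot all_order all_algebra all_fingroup.
From mathcomp Require Import all_solvable ring.

(** Let [s] have order [q] in [F_p^*], and let [V] carry an [F_q]-valued
    quadratic form [Q] with nondegenerate polar form [b], and an action by
    isometries of the affine maps [i |-> c + s^f i] of [F_p].  On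
    [F_p x V x F_q] put [phi (c, v, a) = a - Q v] and
      [lambda_(c,v,a) (d, w, e) = (s^phi d, h w, e + b (v, h w))],
    where [h] is the action of [(c, s^phi)].  Then [phi] is additive for the
    product [x + lambda_x y], so [lambda] is multiplicative, which makes this
    product a left brace structure.

    Every nonzero ideal contains a nonzero element of [F_p]: an element of
    nonzero phase moves [F_p], and [b] produces such an element from any
    [v <> 0].  Conversely the translations by [F_p] have no fixed vector, so the
    ideal generated by [F_p] contains [V], hence, through [b], also [F_q].

    For [V] take [k] copies of the zero-sum functions [F_p -> F_q], permuted by
    the affine maps.  The form [sum_(i < j) v_i v_j] is invariant and its polar
    form there is [- sum_i v_i w_i], also when [q = 2]; it is nondegenerate
    because [p] is invertible in [F_q]. *)

Set Implicit Arguments.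
Unset Strict Implicit.
Unset Printing Implicit Defensive.

Import GRing.Theory.
Local Open Scope ring_scope.

(** Allows an additively closed set to grow from one nonzero scalar to a whole line. *)
Lemma Fp_mulrn (p : nat) (e d : 'F_p) : e != 0 -> exists n, d = e *+ n.
Proof.
move=> e0; exists (d / e : 'F_p); rewrite -mulr_natr natr_Zp.
by rewrite mulrC divfK.
Qed.

(** * Additive closure of ideals in a left brace *)

Section BraceIdeals.
Variables (B : finLeftBraceType) (I : {group B}).
Implicit Types x y b : B.

Lemma brace_oneg : 1%g = 0 :> B.
Proof.
have := brace_mulgDr (1%g : B) 1%g 0; rewrite !mul1g.
by rewrite -addrA => /addrI; rewrite add0r.
Qed.

Hypothesis idealI : brace_ideal I.

(** Since [brace_lambda x] undoes [brace_lambda x^-1], the sum is the product of [x] with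
    [brace_lambda x^-1 y]. *)
Lemma ideal_add x y : x \in I -> y \in I -> x + y \in I.
Proof.
case: idealI => _ lamI Ix Iy.
suff -> : x + y = (x * brace_lambda x^-1%g y)%g by rewrite groupM ?lamI.
have := brace_mulgDr x ((x^-1 * y)%g - x^-1%g) x^-1%g.
rewrite subrK mulKVg mulgV brace_oneg addr0 /brace_lambda => <-.
by rewrite addrC.
Qed.

Lemma ideal_opp x : x \in I -> - x \in I.
Proof.
case: idealI => _ lamI Ix.
have -> : - x = brace_lambda x x^-1%g.
  by rewrite /brace_lambda mulgV brace_oneg sub0r.
by rewrite lamI ?groupV.
Qed.

Lemma ideal_mulrn x n : x \in I -> x *+ n \in I.
Proof.
move=> Ix; elim: n => [|n IHn]; first by rewrite mulr0n -brace_oneg group1.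
by rewrite mulrS ideal_add.
Qed.

(** Rewriting [x * b] as [b * x ^ b] turns the element into [brace_lambda b (x ^ b) - x], where
    normality applies. This is the main source of new elements of an ideal. *)
Lemma ideal_star x b : x \in I -> brace_lambda x b - b \in I.
Proof.
case: (idealI) => /andP[_ /subsetP nI] lamI Ix.
have -> : brace_lambda x b - b = brace_lambda b (x ^ b)%g - x.
  by rewrite /brace_lambda -conjgC addrAC.
by rewrite ideal_add ?ideal_opp ?lamI ?memJ_norm // nI ?inE.
Qed.

End BraceIdeals.

(** * Quadratic data and the left braces they define *)

Definition polar (V L : zmodType) (Q : V -> L) (v w : V) : L :=
  Q (v + w) - Q v - Q w.

(* [act c f] is the action of the affine map [i |-> c + scale f * i]. *)
Record quadratic_datum (p q : nat) (V : finZmodType) := QuadraticDatum {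
  scale : 'F_q -> 'F_p;
  scaleD : {morph scale : f g / f + g >-> f * g};
  scale0 : scale 0 = 1;
  scale_neq1 : forall f, f != 0 -> scale f != 1;
  act : 'F_p -> 'F_q -> V -> V;
  actD : forall c f, {morph act c f : v w / v + w};
  act0 : forall v, act 0 0 v = v;
  actM : forall c d f g v,
    act (c + scale f * d) (f + g) v = act c f (act d g v);
  act_fixed : forall c v, c != 0 -> act c 0 v = v -> v = 0;
  form : V -> 'F_q;
  form_act : forall c f v, form (act c f v) = form v;
  polarDr : forall u, {morph polar form u : v w / v + w};
  polar_nondeg : forall v, v != 0 -> exists w, polar form v w != 0
}.

Definition twist p q V (D : quadratic_datum p q V) : Type :=
  ('F_p * V * 'F_q)%type.

Section Twist.
Variables (p q : nat) (V : finZmodType) (D : quadratic_datum p q V).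

HB.instance Definition _ := Finite.copy (twist D) ('F_p * V * 'F_q)%type.
HB.instance Definition _ := GRing.Zmodule.copy (twist D) ('F_p * V * 'F_q)%type.

Local Notation s := (scale D).
Local Notation Q := (form D).
Local Notation "<< v , w >>" := (polar Q v w).

Implicit Types (v w : V) (x y z : twist D).

Lemma polarC v w : <<v, w>> = <<w, v>>.
Proof. by rewrite /polar (addrC v) addrAC. Qed.

Lemma polarDl v w u : <<v + w, u>> = <<v, u>> + <<w, u>>.
Proof. by rewrite polarC polarDr !(polarC u). Qed.

Lemma polar0r v : <<v, 0>> = 0.
Proof. by apply: (addrI <<v, 0>>); rewrite -polarDr !addr0. Qed.

Lemma polarNr v w : <<v, - w>> = - <<v, w>>.
Proof. by apply/eqP; rewrite -subr_eq0 opprK -polarDr addNr polar0r. Qed.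

Lemma polarNl v w : <<- v, w>> = - <<v, w>>.
Proof. by rewrite polarC polarNr polarC. Qed.

Lemma polar_act c f v w : <<act D c f v, act D c f w>> = <<v, w>>.
Proof. by rewrite /polar -actD !form_act. Qed.

Lemma formD v w : Q (v + w) = Q v + Q w + <<v, w>>.
Proof. by rewrite /polar; ring. Qed.

Lemma form0 : Q 0 = 0.
Proof.
have := polar0r 0; rewrite /polar addr0 subrr sub0r => /eqP.
by rewrite oppr_eq0 => /eqP.
Qed.

Lemma formN v : Q (- v) = <<v, v>> - Q v.
Proof.
have := formD v (- v); rewrite subrr form0 polarNr => E.
by apply/eqP; rewrite -subr_eq0 E; apply/eqP; ring.
Qed.

Lemma act_zero c f : act D c f 0 = 0.
Proof. by apply: (addrI (act D c f 0)); rewrite -actD !addr0. Qed.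

Lemma actN c f v : act D c f (- v) = - act D c f v.
Proof. by apply/eqP; rewrite -subr_eq0 opprK -actD addNr act_zero. Qed.

Definition twist_phase x : 'F_q := x.2 - Q x.1.2.
Local Notation phi := twist_phase.

Definition twist_lambda x y : twist D :=
  let w := act D x.1.1 (phi x) y.1.2 in
  (s (phi x) * y.1.1, w, y.2 + <<x.1.2, w>>).

Definition twist_mul x y : twist D := x + twist_lambda x y.

(** Solves [y + twist_lambda y x = 0] coordinatewise for [y], given that [phi y] must be
    [- phi x]. *)
Definition twist_inv x : twist D :=
  let c := - (s (- phi x) * x.1.1) in
  (c, - act D c (- phi x) x.1.2, <<x.1.2, x.1.2>> - x.2).

(** The polar term added in the last coordinate cancels the one from [formD], and the action
    preserves [Q]. *)
Lemma phase_mul x y : phi (twist_mul x y) = phi x + phi y.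
Proof.
case: x y => [[c v] a] [[d w] b]; rewrite /phi /= formD form_act.
by ring.
Qed.

Lemma phase_inv x : phi (twist_inv x) = - phi x.
Proof.
case: x => [[c v] a]; rewrite /phi /= formN.
by rewrite polar_act form_act; ring.
Qed.

Lemma twist_lambdaD x : {morph twist_lambda x : y z / y + z}.
Proof.
case: x => [[c v] a] [[d w] b] [[e u] r]; congr (_, _, _) => /=.
- by rewrite mulrDr.
- by rewrite actD.
- by rewrite actD polarDr addrACA.
Qed.

(** In the last coordinate the polar form splits in its first argument, and invariance under the
    action of [x] removes that action from the second summand. *)
Lemma twist_lambdaM x y z :
  twist_lambda (twist_mul x y) z = twist_lambda x (twist_lambda y z).
Proof.
rewrite /twist_lambda phase_mul.
case: x y z => [[c v] a] [[d w] b] [[e u] r] /=.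
rewrite scaleD actM polarDl polar_act mulrA; congr (_, _, _).
by ring.
Qed.

Lemma twist_mulA : associative twist_mul.
Proof.
by move=> x y z; rewrite {1 3}/twist_mul twist_lambdaM twist_lambdaD addrA.
Qed.

Lemma twist_mul0 : left_id 0 twist_mul.
Proof.
case=> [[d w] b]; rewrite /twist_mul /twist_lambda /phi /= form0 subrr.
by rewrite scale0 mul1r act0 polarC polar0r addr0 add0r.
Qed.

Lemma twist_mulV : left_inverse 0 twist_inv twist_mul.
Proof.
move=> x; rewrite /twist_mul /twist_lambda phase_inv /=.
case: x => [[c v] a]; congr (_, _, _) => /=; rewrite ?addNr //.
by rewrite polarNl polar_act; ring.
Qed.

HB.instance Definition _ :=
  Finite_isGroup.Build (twist D) twist_mulA twist_mul0 twist_mulV.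

Lemma twist_brace x y z : (x * (y + z))%g + x = (x * y)%g + (x * z)%g.
Proof.
rewrite /mulg /= /twist_mul twist_lambdaD addrACA addrA.
by rewrite -!addrA; congr (_ + _); rewrite addrA addrC.
Qed.

HB.instance Definition _ :=
  Zmodule_Group_isLeftBrace.Build (twist D) twist_brace.

Lemma brace_lambda_twist x y : brace_lambda x y = twist_lambda x y.
Proof. by rewrite /brace_lambda /mulg /= /twist_mul addrC addKr. Qed.

(** * Ideals of the constructed brace and its simplicity *)

Section Ideal.
Variable I : {group twist D}.
Hypothesis idealI : brace_ideal I.

Let eq_mem_ideal x y : y = x -> x \in I -> y \in I.
Proof. by move=> ->. Qed.

(** Apply [ideal_star] to [(1, 0, 0)]: only the scaling by [s (phi x)] is seen. *)
Lemma twist_ideal_phase x :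
  x \in I -> phi x != 0 -> exists2 d : 'F_p, d != 0 & (d, 0, 0) \in I.
Proof.
move=> Ix phi0; exists (s (phi x) - 1); first by rewrite subr_eq0 scale_neq1.
have := ideal_star idealI (1, 0, 0) Ix.
rewrite brace_lambda_twist /twist_lambda /= act_zero polar0r mulr1.
by apply: eq_mem_ideal; congr (_, _, _); rewrite /= ?subrr ?addr0 ?subr0.
Qed.

Lemma twist_ideal_form v a :
  (0, v, a) \in I -> v != 0 -> exists2 d : 'F_p, d != 0 & (d, 0, 0) \in I.
Proof.
move=> Ix v0; have [phi0|phi0] := eqVneq (phi (0, v, a)) 0; last first.
  exact: twist_ideal_phase Ix phi0.
(* With zero phase, [(0, v, a)] acts trivially on [V], so [ideal_star] at [(0, w, 0)] yields
   [(0, 0, <<v, w>>)], whose phase is nonzero. *)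
have [w w0] := polar_nondeg D v0.
have := ideal_star idealI (0, w, 0) Ix.
rewrite brace_lambda_twist /twist_lambda phi0 /= act0 mulr0.
move=> H; apply: (twist_ideal_phase H).
by rewrite /phi /= subrr form0 subr0 add0r subr0.
Qed.

Lemma twist_ideal_scalar x :
  (exists v, v != 0) -> x \in I -> x != 0 ->
  exists2 d : 'F_p, d != 0 & (d, 0, 0) \in I.
Proof.
case: x => [[c v] a] [w w0] Ix x0.
have [phi0|phi0] := eqVneq (phi (c, v, a)) 0; last first.
  exact: twist_ideal_phase Ix phi0.
have [c0|c0] := eqVneq c 0; last first.
  (* At zero phase [x] acts on [V] as the translation by [c], which does not fix [w]; hence the new
     element has a nonzero [V]-coordinate. *)
  have := ideal_star idealI (0, w, 0) Ix.
  rewrite brace_lambda_twist /twist_lambda phi0 /= mulr0.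
  move=> H; apply: (@twist_ideal_form (act D c 0 w - w) <<v, act D c 0 w>>).
    move: H; apply: eq_mem_ideal.
    by congr (_, _, _); rewrite /= ?subrr ?add0r ?subr0.
  by apply: contra_neq w0 => /eqP; rewrite subr_eq0 => /eqP; apply: act_fixed.
(* If [v] vanished as well, zero phase would force [a = 0]. *)
subst c; apply: twist_ideal_form Ix _; apply: contra_neq x0 => v0.
by move: phi0; rewrite v0 /phi /= form0 subr0 => ->.
Qed.

Lemma twist_ideal_full (d : 'F_p) :
  (exists v, v != 0) -> d != 0 -> (d, 0, 0) \in I -> forall x, x \in I.
Proof.
move=> [v0 v0P] d0 Id.
have Ic c : ((c, 0, 0) : twist D) \in I.
  have [n ->] := Fp_mulrn c d0; have := ideal_mulrn idealI n Id.
  by apply: eq_mem_ideal; elim: n => // n IHn; rewrite !mulrS -IHn;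
    congr (_, _, _); rewrite /= ?addr0.
have Iv v : ((0, v, 0) : twist D) \in I.
  (* The kernel consists of vectors fixed by a translation, so it is zero; as [V] is finite the map
     is onto, and every [v] arises from [ideal_star]. *)
  have inj : injective (fun w => act D 1 0 w - w).
    move=> u w /= E; apply/eqP; rewrite -subr_eq0; apply/eqP.
    apply: (@act_fixed _ _ _ D 1); first exact: oner_neq0.
    rewrite actD actN -[act D 1 0 u](subrK u) E.
    by rewrite addrC -addrA addKr addrC.
  have [g _ gK] := injF_bij inj; rewrite -(gK v); set w := g v.
  have := ideal_star idealI (0, w, 0) (Ic 1).
  rewrite brace_lambda_twist /twist_lambda /phi /= form0 subrr polarC polar0r.
  by apply: eq_mem_ideal; congr (_, _, _); rewrite /= ?mulr0 ?addr0 ?subrr.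
have [e e0 Ie] : exists2 e, e != 0 & ((0, 0, e) : twist D) \in I.
  have [w w0] := polar_nondeg D v0P.
  exists <<v0, w>> => //.
  (* The phase of [(0, v0, 0)] may be nonzero, so [u] is chosen to be carried to [w]. Then
     [ideal_star] gives [(0, w - u, <<v0, w>>)], and adding [(0, u - w, 0)] leaves the scalar. *)
  set f := phi (0, v0, 0); pose u := act D 0 (- f) w.
  have uK : act D 0 f u = w.
    by rewrite /u -actM mulr0 addr0 subrr act0.
  have H := ideal_star idealI (0, u, 0) (Iv v0).
  have := ideal_add idealI H (Iv (u - w)); rewrite brace_lambda_twist.
  rewrite /twist_lambda /= -/f uK; apply: eq_mem_ideal; congr (_, _, _) => /=.
  - by rewrite mulr0 subrr addr0.
  - by rewrite addrC subrKA subrr.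
  - by rewrite add0r subr0 addr0.
have Ia a : ((0, 0, a) : twist D) \in I.
  have [n ->] := Fp_mulrn a e0; have := ideal_mulrn idealI n Ie.
  by apply: eq_mem_ideal; elim: n => // n IHn; rewrite !mulrS -IHn;
    congr (_, _, _); rewrite /= ?addr0.
case=> [[c v] a].
have -> : (c, v, a) = (c, 0, 0) + (0, v, 0) + (0, 0, a) :> twist D.
  by congr (_, _, _); rewrite /= ?addr0 ?add0r.
by rewrite !(ideal_add idealI).
Qed.

End Ideal.

Lemma twist_simple : (exists v, v != 0) -> simple_left_brace (twist D).
Proof.
move=> V0; split.
  by case: V0 => v v0; exists (0, v, 0); apply: contra_neq v0 => -[].
move=> I idealI.
have [/existsP[x /andP[Ix x0]]|noI] := boolP [exists x in I, x != 0].
  right; have [d d0 Id] := twist_ideal_scalar idealI V0 Ix x0.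
  by apply/setP=> y; rewrite inE (twist_ideal_full idealI V0 d0 Id).
left; apply/setP=> x; rewrite !inE; apply/idP/eqP => [Ix|->].
  by apply: contraNeq noI => x0; apply/existsP; exists x; rewrite Ix.
exact: group1.
Qed.
End Twist.

(** * The form summing products over unordered pairs *)

Section PairSum.
Variables (T : finType) (L : comNzRingType).
Implicit Types (u v w : T -> L) (i j : T).

Let swap_inj : injective (fun t : T * T => (t.2, t.1)).
Proof. by apply: (can_inj (g := fun t => (t.2, t.1))) => -[]. Qed.

Definition is_tournament (r : rel T) :=
  forall i j, r i j = (i != j) && ~~ r j i.

(* A permutation of [T] turns the order [idx_lt] into another tournament, so
   this makes [pair_sum] symmetric with no division by 2. *)
Lemma tournament_sum (F : T -> T -> L) (r r' : rel T) :
  (forall i j, F i j = F j i) -> is_tournament r -> is_tournament r' ->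
  \sum_(t : T * T | r t.1 t.2) F t.1 t.2 = \sum_(t | r' t.1 t.2) F t.1 t.2.
Proof.
move=> Fsym rP r'P.
rewrite [LHS](bigID (fun t => r' t.1 t.2)) [RHS](bigID (fun t => r t.1 t.2)) /=.
congr (_ + _); first by apply: eq_bigl => t; rewrite andbC.
(* The pairs in [r] but not in [r'] are the reversals of those in [r'] but not in [r]. *)
rewrite (reindex_inj swap_inj); apply: eq_big => [[i j]|[i j] _] //=.
rewrite (rP i j) (r'P i j); have [->|_] /= := eqVneq i j.
  by rewrite rP eqxx.
by rewrite negbK andbC.
Qed.

Definition idx_lt i j := (enum_rank i < enum_rank j)%N.

Lemma idx_lt_tournament : is_tournament idx_lt.
Proof.
move=> i j; rewrite /idx_lt -leqNgt ltn_neqAle.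
by rewrite (inj_eq val_inj) (inj_eq enum_rank_inj).
Qed.

Definition pair_sum v : L := \sum_(t : T * T | idx_lt t.1 t.2) v t.1 * v t.2.

Lemma pair_sum_perm (h : T -> T) v :
  injective h -> pair_sum (v \o h) = pair_sum v.
Proof.
move=> inj_h; pose r i j := idx_lt (invF inj_h i) (invF inj_h j).
have rP : is_tournament r.
  move=> i j; rewrite /r {1}idx_lt_tournament.
  by rewrite (inj_eq (can_inj (f_invF inj_h))).
have vC i j : v i * v j = v j * v i by rewrite mulrC.
rewrite /pair_sum [RHS](tournament_sum vC idx_lt_tournament rP).
have inj2 : injective (fun t : T * T => (h t.1, h t.2)).
  by move=> [a b] [c d] [/inj_h -> /inj_h ->].
by rewrite [RHS](reindex_inj inj2); apply: eq_bigl => t; rewrite /r /= !invF_f.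
Qed.

(** The product of the two sums is a sum over all ordered pairs; removing the diagonal leaves both
    orientations of each unordered pair, which are the cross terms on the left. *)
Lemma pair_sum_polar v w :
  pair_sum (fun i => v i + w i) - pair_sum v - pair_sum w
    = (\sum_i v i) * (\sum_i w i) - \sum_i v i * w i.
Proof.
have -> : (\sum_i v i) * (\sum_i w i) = \sum_(t : T * T) v t.1 * w t.2.
  rewrite big_distrl -(pair_bigA _ (fun i j => v i * w j)) /=.
  by apply: eq_bigr => i _; rewrite big_distrr.
rewrite [in RHS](bigID (fun t => idx_lt t.1 t.2)) /=.
rewrite [X in _ = _ + X - _](bigID (fun t => t.1 == t.2)) /=.
have -> : \sum_(t : T * T | ~~ idx_lt t.1 t.2 && (t.1 == t.2)) v t.1 * w t.2
   = \sum_i v i * w i.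
  rewrite (reindex_onto (fun i => (i, i)) fst) /=; last first.
    by move=> [i j] /= /andP[_ /eqP ->].
  by apply: eq_bigl => i; rewrite /idx_lt ltnn !eqxx.
rewrite [X in _ = _ + (_ + X) - _](reindex_inj swap_inj) /=.
have -> : \sum_(t : T * T | ~~ idx_lt t.2 t.1 && (t.2 != t.1)) v t.2 * w t.1
   = \sum_(t : T * T | idx_lt t.1 t.2) v t.2 * w t.1.
  by apply: eq_bigl => t; rewrite [RHS]idx_lt_tournament andbC eq_sym.
rewrite /pair_sum.
have -> : \sum_(t : T * T | idx_lt t.1 t.2) (v t.1 + w t.1) * (v t.2 + w t.2)
  = \sum_(t : T * T | idx_lt t.1 t.2) v t.1 * v t.2 +
   \sum_(t : T * T | idx_lt t.1 t.2) w t.1 * w t.2 +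
   \sum_(t : T * T | idx_lt t.1 t.2) v t.1 * w t.2 +
   \sum_(t : T * T | idx_lt t.1 t.2) v t.2 * w t.1.
  by rewrite -!big_split; apply: eq_bigr => t _ /=; ring.
by ring.
Qed.

End PairSum.

(** * The group of functions with sum zero *)

Section ZeroSum.
Variables (T : finType) (L : zmodType).

Definition zero_sum_pred : {pred {ffun T -> L}} := fun u => \sum_i u i == 0.

Fact zero_sum_zmod_closed : zmod_closed zero_sum_pred.
Proof.
split=> [|u v /eqP u0 /eqP v0]; rewrite unfold_in.
  by rewrite big1 // => i _; rewrite ffunE.
under eq_bigr do rewrite !ffunE.
by rewrite sumrB u0 v0 subrr.
Qed.

HB.instance Definition _ :=
  GRing.isZmodClosed.Build _ zero_sum_pred zero_sum_zmod_closed.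

Record zero_sum := ZeroSum {
  zero_sum_val :> {ffun T -> L};
  _ : zero_sum_val \in zero_sum_pred
}.

HB.instance Definition _ := [isSub for zero_sum_val].
HB.instance Definition _ := [Choice of zero_sum by <:].
HB.instance Definition _ := [SubChoice_isSubZmodule of zero_sum by <:].

Lemma zero_sumP (u : zero_sum) : \sum_i u i = 0.
Proof. by case: u => u /= /eqP. Qed.

Lemma zero_sumD (u v : zero_sum) i : (u + v) i = u i + v i.
Proof. by rewrite -[zero_sum_val (u + v)]/(val (u + v)) raddfD ffunE. Qed.

Lemma zero_sum0 i : (0 : zero_sum) i = 0.
Proof. by rewrite -[zero_sum_val 0]/(val (0 : zero_sum)) raddf0 ffunE. Qed.

Fact reindex_zero_sum_subproof (h : {perm T}) (u : zero_sum) :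
  [ffun i => u (h i)] \in zero_sum_pred.
Proof.
rewrite unfold_in -[X in _ == X](zero_sumP u) [X in _ == X](reindex_perm h).
by apply/eqP; apply: eq_bigr => i _; rewrite ffunE.
Qed.

Definition reindex_zero_sum (h : {perm T}) (u : zero_sum) : zero_sum :=
  ZeroSum (reindex_zero_sum_subproof h u).

End ZeroSum.

HB.instance Definition _ (T : finType) (L : finZmodType) :=
  [Finite of zero_sum T L by <:].
HB.instance Definition _ (T : finType) (V : finZmodType) :=
  GRing.Zmodule.on {ffun T -> V}.

Lemma zero_sum_const (T : finType) (q : nat) (u : zero_sum T 'F_q) i0 :
  #|T|%:R != 0 :> 'F_q -> (forall i, u i = u i0) -> u = 0.
Proof.
move=> T0 uc; have := zero_sumP u; under eq_bigr do rewrite uc.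
rewrite sumr_const -mulr_natr => /eqP.
rewrite mulf_eq0 (negPf T0) orbF => /eqP ui0.
by apply/val_inj/ffunP => i; rewrite /= uc ui0 zero_sum0.
Qed.

(** As [#|T|] is invertible, each function splits uniquely into its average and a zero-sum part. *)
Lemma card_zero_sum (T : finType) (q : nat) :
  prime q -> #|T|%:R != 0 :> 'F_q ->
  #|{: zero_sum T 'F_q}| = (q ^ #|T|.-1)%N.
Proof.
move=> pq T0; have Tgt0: (0 < #|T|)%N.
  by rewrite lt0n; apply: contra_neq T0 => ->.
suff E : #|{: zero_sum T 'F_q * 'F_q}| = #|{ffun T -> 'F_q}|.
  move: E; rewrite card_prod card_ffun !card_Fp // => E; apply/eqP.
  by rewrite -(eqn_pmul2r (prime_gt0 pq)) E -expnSr prednK.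
pose avg (u : {ffun T -> 'F_q}) : 'F_q := (\sum_i u i) / #|T|%:R.
have avgP (u : {ffun T -> 'F_q}) :
    [ffun i => u i - avg u] \in @zero_sum_pred T 'F_q.
  rewrite unfold_in; under eq_bigr do rewrite ffunE.
  by rewrite sumrB sumr_const -mulr_natr divfK // subrr.
pose f (t : zero_sum T 'F_q * 'F_q) := [ffun i => t.1 i + t.2].
pose g u := (ZeroSum (avgP u), avg u).
apply: (@bij_eq_card _ _ f); exists g => [[u c]|u]; last first.
  by apply/ffunP => i; rewrite !ffunE subrK.
have fE : avg (f (u, c)) = c.
  rewrite /avg; under eq_bigr do rewrite ffunE /=.
  by rewrite big_split /= zero_sumP add0r sumr_const -(mulr_natr c) mulfK.
rewrite /g; congr (_, _); last exact: fE.
apply/val_inj/ffunP => i.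
by rewrite /= !ffunE fE addrK.
Qed.

(** * The affine action on zero-sum functions over ['F_p] *)

Section Datum.
Variables (p q k : nat) (pp : prime p) (pq : prime q) (npq : p <> q).
Variable x : {unit 'F_p}.
Hypothesis xq : #[x]%g = q.

Local Notation W := (zero_sum 'F_p 'F_q).
Local Notation V := {ffun 'I_k -> W}.

Definition unit_scale (f : 'F_q) : 'F_p := FinRing.uval (x ^+ f)%g.

Lemma unit_scaleD : {morph unit_scale : f g / f + g >-> f * g}.
Proof.
move=> f g; rewrite /unit_scale -FinRing.val_unitM -expgD.
rewrite -[(x ^+ (f + g)%N)%g]expg_mod_order xq.
(* The modulus built into ['F_q] is [q] because [q] is prime; exponents of [x] are thus added modulo
   its order. *)
have modq m : (m %% (Zp_trunc (pdiv q)).+2 = m %% q)%N by rewrite (Fp_cast pq).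
by rewrite /= modq.
Qed.

Lemma unit_scale0 : unit_scale 0 = 1.
Proof. by rewrite /unit_scale expg0. Qed.

Lemma unit_scale_neq0 f : unit_scale f != 0.
Proof. by rewrite -unitfE; apply: (valP (x ^+ f)%g). Qed.

Lemma unit_scale_neq1 f : f != 0 -> unit_scale f != 1.
Proof.
apply: contra_neq => E; have {E} : (x ^+ f = 1)%g by apply: val_inj.
move=> /eqP; rewrite -order_dvdn xq => qf; apply: val_inj => /=.
have := ltn_ord f; rewrite [X in (_ < X)%N](Fp_cast pq) => fq; apply/eqP.
by rewrite -leqn0 leqNgt; apply/negP => /dvdn_leq /(_ qf); rewrite leqNgt fq.
Qed.

(** This is the inverse of [i |-> c + unit_scale f * i]; composing functions with the inverse makes
    [affine_act] a left action. *)
Fact affine_inj (c : 'F_p) (f : 'F_q) :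
  injective (fun i => (i - c) / unit_scale f).
Proof.
by move=> i j /(divIf (unit_scale_neq0 f)) /addIr.
Qed.

Definition affine_act (c : 'F_p) (f : 'F_q) (v : V) : V :=
  [ffun r => reindex_zero_sum (perm (@affine_inj c f)) (v r)].

Lemma affine_actE c f v r i :
  affine_act c f v r i = v r ((i - c) / unit_scale f).
Proof. by rewrite ffunE ffunE permE. Qed.

Lemma affine_actD c f : {morph affine_act c f : v w / v + w}.
Proof.
move=> v w; apply/ffunP => r; apply/val_inj/ffunP => i /=.
rewrite affine_actE [(v + w) r]ffunE [in RHS]ffunE !zero_sumD.
by rewrite !affine_actE.
Qed.

Lemma affine_act0 v : affine_act 0 0 v = v.
Proof.
apply/ffunP => r; apply/val_inj/ffunP => i /=.
by rewrite affine_actE unit_scale0 subr0 divr1.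
Qed.

Lemma affine_actM c d f g v :
  affine_act (c + unit_scale f * d) (f + g) v
    = affine_act c f (affine_act d g v).
Proof.
apply/ffunP => r; apply/val_inj/ffunP => i /=.
rewrite !affine_actE unit_scaleD; congr (v r _).
by field; rewrite !unit_scale_neq0.
Qed.

Lemma card_Fp_neq0 : #|'F_p|%:R != 0 :> 'F_q.
Proof.
rewrite card_Fp // -(dvdn_pcharf (pchar_Fp pq)) dvdn_prime2 //.
by apply/eqP => /esym.
Qed.

(** A nonzero [c] generates ['F_p] additively, so each component is constant, and a constant
    function of sum zero vanishes here. *)
Lemma affine_act_fixed c v : c != 0 -> affine_act c 0 v = v -> v = 0.
Proof.
move=> c0 vE; apply/ffunP => r; rewrite ffunE.
have shift i : v r i = v r (i - c).
  by rewrite -{1}vE affine_actE unit_scale0 divr1.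
apply: (@zero_sum_const _ _ _ 0); first exact: card_Fp_neq0.
move=> i; have [n ->] := Fp_mulrn i c0.
by elim: n => // n IHn; rewrite shift mulrSr addrK.
Qed.

Definition sum_form (v : V) : 'F_q := \sum_r pair_sum (v r).

Lemma sum_form_act c f v : sum_form (affine_act c f v) = sum_form v.
Proof.
apply: eq_bigr => r _; rewrite -(pair_sum_perm (v r) (@affine_inj c f)).
by apply: eq_bigr => t _; rewrite !affine_actE.
Qed.

Lemma polar_sum_form v w :
  polar sum_form v w = - \sum_r \sum_i v r i * w r i.
Proof.
rewrite /polar /sum_form -!sumrB -sumrN; apply: eq_bigr => r _.
have := pair_sum_polar (v r) (w r); rewrite zero_sumP mul0r sub0r => <-.
congr (_ - _ - _); apply: eq_bigr => t _.
by rewrite [(v + w) r]ffunE !zero_sumD.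
Qed.

Lemma polar_sum_formDr u : {morph polar sum_form u : v w / v + w}.
Proof.
move=> v w; rewrite !polar_sum_form -opprD -big_split; congr (- _).
apply: eq_bigr => r _; rewrite -big_split; apply: eq_bigr => i _ /=.
by rewrite [(v + w) r]ffunE zero_sumD mulrDr.
Qed.

Definition delta_diff (i j : 'F_p) : {ffun 'F_p -> 'F_q} :=
  [ffun l => (l == i)%:R - (l == j)%:R].

Fact delta_diff_subproof i j : delta_diff i j \in @zero_sum_pred 'F_p 'F_q.
Proof.
rewrite unfold_in; under eq_bigr do rewrite ffunE.
by rewrite sumrB -!natr_sum -!big_mkcond !sum1_card !card1 subrr.
Qed.

(** Some component [v r] is nonzero, hence not constant. Pairing it with the indicator of [i] minus
    that of [0] gives [v r i - v r 0] up to sign, nonzero for a suitable [i]. *)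
Lemma polar_sum_form_nondeg v : v != 0 -> exists w, polar sum_form v w != 0.
Proof.
move=> v0.
have [/forallP vr0|] := boolP [forall r, v r == 0].
  by case/eqP: v0; apply/ffunP => r; rewrite ffunE; apply/eqP.
case/forallPn => r vr0.
have [/forallP vc|] := boolP [forall i, v r i == v r 0].
  by case/eqP: vr0; apply: (zero_sum_const card_Fp_neq0) => i; apply/eqP/vc.
case/forallPn => i vi.
pose w : V :=
  [ffun r' => if r' == r then ZeroSum (delta_diff_subproof i 0) else 0].
exists w; rewrite polar_sum_form oppr_eq0 (bigD1 r) //=.
rewrite [X in _ + X]big1 => [|r' r'r].
  rewrite addr0 ffunE eqxx /=.
  under eq_bigr do rewrite ffunE mulrBr.
  rewrite sumrB (bigD1 i) //= eqxx mulr1 big1 => [|j /negPf ->]; last first.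
    by rewrite mulr0.
  rewrite (bigD1 0) //= mulr1 big1 => [|j /negPf ->]; last by rewrite mulr0.
  by rewrite !addr0 subr_eq0.
by rewrite big1 // => j _; rewrite ffunE (negPf r'r) zero_sum0 mulr0.
Qed.

Definition affine_datum : quadratic_datum p q V :=
  QuadraticDatum unit_scaleD unit_scale0 unit_scale_neq1 affine_actD
    affine_act0 affine_actM affine_act_fixed sum_form_act polar_sum_formDr
    polar_sum_form_nondeg.

Lemma card_twist_affine :
  #|{: twist affine_datum}| = (p * q ^ (k * (p - 1) + 1))%N.
Proof.
rewrite /twist !card_prod card_ffun card_zero_sum ?card_Fp_neq0 //.
rewrite !card_Fp // card_ord -expnM -mulnA -expnSr.
by rewrite addn1 subn1 [(k * _)%N]mulnC.
Qed.

Lemma ffun_zero_sum_neq0 : (0 < k)%N -> exists v : V, v != 0.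
Proof.
move=> k0; have /card_gt1P[v [w [_ _ vw]]] : (1 < #|{: V}|)%N.
  rewrite card_ffun card_ord card_zero_sum ?card_Fp_neq0 // card_Fp //.
  rewrite -expnM -{1}(expn0 q) ltn_exp2l ?prime_gt1 // muln_gt0 k0 andbT.
  by rewrite -ltnS prednK ?prime_gt0 ?prime_gt1.
by exists (v - w); rewrite subr_eq0.
Qed.

End Datum.

Theorem mainTheorem4 (p1 p2 k : nat) (hp1 : prime p1) (hp2 : prime p2)
    (hp12 : p1 <> p2) (hdvd : (p2 %| p1 - 1)%N) (hk : (0 < k)%N) :
  exists B : finLeftBraceType,
    #|B| = (p1 * p2 ^ (k * (p1 - 1) + 1))%N /\ simple_left_brace B.
Proof.
have [|x _ xq] := @Cauchy _ p2 [set: {unit 'F_p1}] hp2.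
  by rewrite card_finField_unit card_Fp // -subn1.
exists (twist (affine_datum k hp1 hp2 hp12 xq)).
split; [exact: card_twist_affine | exact/twist_simple/ffun_zero_sum_neq0].
Qed.
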